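(* Let $n>1$ be an integer with $n\equiv 1\pmod 4$. Then $$\sum_{k=0}^{n-1}\frac{(q;q^4)_k^4}{(q^4;q^4)_k^4}q^{4k}\equiv q^{(n-1)/4}\,\frac{(q;q^2)_{(n-1)/4}^2\,(q^2;q^4)_{(n-1)/4}}{(q^2;q^2)_{(n-1)/4}^2\,(q^4;q^4)_{(n-1)/4}}\pmod{\Phi_n(q)}.$$
   Context: Here $q$ is an indeterminate. For a nonnegative integer $k$, $(a;q)_k=(1-a)(1-aq)\cdots(1-aq^{k-1})$ (with $(a;q)_0=1$); the base may be replaced, e.g. $(a;q^4)_k=(1-a)(1-aq^4)\cdots(1-aq^{4(k-1)})$. The $n$-th cyclotomic polynomial is $\Phi_n(q)=\prod_{1\le j\le n,\ \gcd(j,n)=1}(q-\zeta^j)$, where $\zeta$ is a primitive $n$-th root of unity. Congruence convention: for rational functions $F(q),G(q)$ in $q$ (over $\mathbb{Z}[q]$), $F(q)\equiv G(q)\pmod{\Phi_n(q)}$ means that $F(q)-G(q)$ can be written as $U(q)/V(q)$ with $U(q),V(q)\in\mathbb{Z}[q]$, $\gcd(V(q),\Phi_n(q))=1$ and $\Phi_n(q)\mid U(q)$. *)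

(* Defs.v *)
(* MathComp *)
From HB Require Import structures.
From mathcomp Require Import all_boot all_order all_algebra all_field.

Set Implicit Arguments.
Unset Strict Implicit.
Unset Printing Implicit Defensive.

Import GRing.Theory.

Local Open Scope ring_scope.

Notation ratfun := {fraction {poly int}}.

Definition q : ratfun := tofrac 'X.

(* (a; b)_k, the q-shifted factorial with an arbitrary base b. *)
Definition qpoch (R : comNzRingType) (a b : R) (k : nat) : R :=
  \prod_(i < k) (1 - a * b ^+ i).

(* Divisibility in Z[q] itself: polydiv's [%|], [gcdp] and [coprimep] use
   pseudo-division over {poly int}, so they ignore constant factors. *)
Definition zdvdp (D P : {poly int}) : Prop := exists W, P = D * W.

Definition zcoprimep (P Q : {poly int}) : Prop :=
  forall D, zdvdp D P -> zdvdp D Q -> D \is a GRing.unit.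

Definition qcongr (M : {poly int}) (F G : ratfun) : Prop :=
  exists U V : {poly int},
    [/\ V != 0, F - G = tofrac U / tofrac V, zcoprimep V M & zdvdp M U].

(* Main.v *)
Require Import Defs.
From mathcomp Require Import all_boot all_order all_algebra all_field.
From mathcomp Require Import ring zify.

Set Implicit Arguments.
Unset Strict Implicit.
Unset Printing Implicit Defensive.

Import GRing.Theory.

Local Open Scope ring_scope.

(** Write n = 4m + 1, let z be a primitive n-th root of unity and x = z^2.

    Both sides are quotients of integer polynomials whose denominators do not
    vanish at z, and Phi_n is, up to base change, the minimal polynomial of z.
    So the congruence says that both sides take the same value at z
    ([qcongr_of_values]), and it remains to prove an identity between complex
    numbers.

    Since z^n = 1, one has z = x^(-2m) = x^(2m+1) and
    z^4 = x^2 = x^(1-4m).  Hence (z; z^4)_k vanishes for k > m, and for k <= m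
    the summand is the case N = m of
      t(N,k) = (x^(-2N); x^2)_k^3 (x^(2N+1); x^2)_k
               / ((x^2; x^2)_k^3 (x^(1-4N); x^2)_k) x^(2k).
    Replacing k by m - k multiplies the summand by x^(2k-m) ([term_rev]), so
    twice the sum is the sum of t(m,k) (1 + x^(2k-m)).  This weight makes the
    series very-well-poised: with base x^2 and s = x^(-N), the sum of
    t(N,k) (1 + x^(2k-N)) is, up to the factor 1 + s, Jackson's terminating
    8phi7 series with leading parameter s^2 and further parameters s^2,
    x^(2N+1), s, s x and s^2.  It therefore has a product evaluation for every
    N ([wsummand_sum]).

    That evaluation is proved by creative telescoping: an explicit rational
    certificate gives a first-order recurrence in N which the product satisfies
    too.  All parameters are powers of x, chosen so that the exponents in the
    denominators have absolute value below 4N, and so no denominator vanishes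
    when x has order 4m + 1 and N <= m.  The induction on N thus runs directly
    at the root of unity, and no limit has to be taken, as it would be if one
    specialised Jackson's formula with N = m fixed and vanishing factors on both
    sides.

    Finally the product is brought to the required form by folding exponents
    modulo n with the reflection formula [qpoch_reflect]. *)

(** * Shifted factorials *)

Lemma qpoch0 (R : comNzRingType) (a b : R) : qpoch a b 0 = 1.
Proof. by rewrite /qpoch big_ord0. Qed.

Lemma qpochSr (R : comNzRingType) (a b : R) k :
  qpoch a b k.+1 = qpoch a b k * (1 - a * b ^+ k).
Proof. by rewrite /qpoch big_ord_recr. Qed.

Lemma qpochD (R : comNzRingType) (a b : R) j k :
  qpoch a b (j + k) = qpoch a b j * qpoch (a * b ^+ j) b k.
Proof.
rewrite /qpoch big_split_ord; congr (_ * _); apply: eq_bigr => i _.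
by rewrite -mulrA -exprD.
Qed.

Lemma qpochSl (R : comNzRingType) (a b : R) k :
  qpoch a b k.+1 = (1 - a) * qpoch (a * b) b k.
Proof. by rewrite -(add1n k) qpochD qpochSr qpoch0 mul1r expr0 mulr1 expr1. Qed.

Lemma qpoch_neq0 (R : idomainType) (a b : R) k :
  (forall i, (i < k)%N -> a * b ^+ i != 1) -> qpoch a b k != 0.
Proof.
move=> h; apply/prodf_neq0 => i _.
by rewrite subr_eq0 eq_sym h.
Qed.

Lemma qpoch_eq0 (R : comNzRingType) (a b : R) i k :
  (i < k)%N -> a * b ^+ i = 1 -> qpoch a b k = 0.
Proof.
by move=> ltik h; rewrite /qpoch (bigD1 (Ordinal ltik)) //= h subrr mul0r.
Qed.

(** The k factors 1 - a b^i and 1 - a' b^(k-1-i) have mutually inverse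
    arguments, and 1 - u = - u (1 - u^-1).  When b is a root of unity this
    exchanges two arguments a and a' that are both powers of b. *)
Lemma qpoch_reflect (K : fieldType) (a a' b : K) k :
  b != 0 -> a * a' * b ^+ k = b ->
  qpoch a b k = (- a) ^+ k * b ^+ 'C(k, 2) * qpoch a' b k.
Proof.
move=> b0 h.
have -> : b ^+ 'C(k, 2) = \prod_(i < k) b ^+ i.
  by rewrite prodrXr -bin2_sum big_mkord.
have -> : (- a) ^+ k = \prod_(i < k) - a by rewrite prodr_const card_ord.
have -> : qpoch a' b k = \prod_(i < k) (1 - a' * b ^+ (k - i.+1)).
  by rewrite /qpoch (reindex_inj rev_ord_inj).
rewrite -!big_split.
apply: eq_bigr => i _ /=; rewrite mulrBr mulr1 !mulNr opprK.
have -> : a * b ^+ i * (a' * b ^+ (k - i.+1)) = 1.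
  apply: (mulIf b0); rewrite mul1r -[RHS]h.
  have -> : b ^+ k = b ^+ (k - i.+1) * (b * b ^+ i).
    by rewrite -exprS -exprD subnK.
  ring.
by rewrite addrC.
Qed.

Lemma bin2_double m : ('C(m, 2) * 2 + m = m * m)%N.
Proof. by elim: m => [|m IH] //; rewrite binS bin1; lia. Qed.

(** * A very-well-poised sum *)

(** The parameters are tied to N so that for x of order 4N + 1 the term becomes
    ((z; z^4)_k / (z^4; z^4)_k)^4 z^(4k), with z the square root x^(-2N) of x. *)
Definition summand (K : fieldType) (x : K) (N k : nat) : K :=
  qpoch (x ^- (2 * N)) (x ^+ 2) k ^+ 3 * qpoch (x ^+ (2 * N + 1)) (x ^+ 2) k
  / (qpoch (x ^+ 2) (x ^+ 2) k ^+ 3 * qpoch (x / x ^+ (4 * N)) (x ^+ 2) k)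
  * x ^+ (2 * k).

Definition wsummand (K : fieldType) (x : K) (N k : nat) : K :=
  summand x N k * (1 + x ^+ (2 * k) / x ^+ N).

(** Half of the value of the sum of [wsummand x N]. *)
Definition closed_form (K : fieldType) (x : K) (N : nat) : K :=
  qpoch x (x ^+ 2) N ^+ 2 * qpoch x x (3 * N)
  / (qpoch x x N ^+ 3 * qpoch x (x ^+ 2) (2 * N) * x ^+ 'C(N.+1, 2)).

(** [rec_new x v] and [rec_old x v], at v = x^N, are the coefficients of the sums
    for N + 1 and N in the recurrence.  They are read off from the quotient
    [closed_form x N.+1 / closed_form x N]. *)
Definition rec_new (K : fieldType) (x v : K) : K :=
  (1 - v * x) ^+ 3 * (1 - v ^+ 4 * x) * (1 - v ^+ 4 * x ^+ 3).

Definition rec_old (K : fieldType) (x v : K) : K :=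
  (1 - x * v ^+ 2) ^+ 2 * (1 - x * v ^+ 3) * (1 - x ^+ 2 * v ^+ 3) *
  (1 - x ^+ 3 * v ^+ 3) / (x * v).

(** The rational certificate, at v = x^N and y = x^(2k).  Gosper's method asks for
    a Laurent polynomial in y solving a first-order difference equation; the
    degrees leave only three coefficients, of which the outer two are
    proportional because of the symmetry between k and N - k. *)
Definition certificate (K : fieldType) (x v y : K) : K :=
  let A := - 1 + v ^+ 3 * (x ^+ 2 + x ^+ 3) + 3 * v ^+ 4 * x ^+ 3
           - 3 * v ^+ 5 * x ^+ 4 - v ^+ 6 * (x ^+ 4 + x ^+ 5) + v ^+ 9 * x ^+ 7 in
  let B := 3 + v - 3 * v ^+ 2 * (x + x ^+ 2) - 3 * v ^+ 3 * x ^+ 2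
           + 3 * v ^+ 5 * x ^+ 4 + 3 * v ^+ 6 * (x ^+ 4 + x ^+ 5)
           - v ^+ 7 * x ^+ 6 - 3 * v ^+ 8 * x ^+ 6 in
  v ^+ 3 * A + v * B * y + A * y ^+ 2 / (v ^+ 2 * x).

(** The common part of the terms of index k + 1 for N and N + 1: each is this
    quantity times a rational function of x, x^N and x^(2k), without poles for
    k <= N.  Factoring it out avoids dividing one term by another, which fails
    at the end of the range, where the term for N is 0. *)
Definition cert_base (K : fieldType) (x : K) (N k : nat) : K :=
  qpoch (x ^- (2 * N)) (x ^+ 2) k ^+ 3 * qpoch (x ^+ (2 * N + 3)) (x ^+ 2) k
  / (qpoch (x ^+ 2) (x ^+ 2) k ^+ 3 * qpoch (x / x ^+ (4 * N)) (x ^+ 2) k).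

Section Telescoping.
Variables (K : fieldType) (x : K) (N : nat).
Hypothesis x_neq0 : x != 0.
Hypothesis x_neq1 : forall i, (0 < i < 4 * N + 4)%N -> x ^+ i != 1.

Let v := x ^+ N.

Lemma v_neq0 : v != 0. Proof. exact: expf_neq0. Qed.

Lemma x_exp_sub_neq0 i j : (i < j < i + 4 * N + 4)%N -> x ^+ i - x ^+ j != 0.
Proof.
move=> h; have -> : j = (i + (j - i))%N by lia.
rewrite exprD -{1}[x ^+ i]mulr1 -mulrBr mulf_neq0 ?expf_neq0 //.
by rewrite subr_eq0 eq_sym x_neq1 //; lia.
Qed.

Lemma x_subr1_neq0 i : (0 < i < 4 * N + 4)%N -> 1 - x ^+ i != 0.
Proof. by move=> h; rewrite subr_eq0 eq_sym x_neq1. Qed.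

(** After dividing by [cert_base x N j], this is an identity of rational
    functions in x, v = x^N and y = x^(2j). *)
Lemma certificate_step j : (j <= N)%N ->
  certificate x v (x ^+ (2 * j)) * cert_base x N j
  + (rec_new x v * wsummand x N.+1 j.+1 - rec_old x v * wsummand x N j.+1)
  = certificate x v (x ^+ (2 * j.+1)) * cert_base x N j.+1.
Proof.
move=> le_jN; have v0 := v_neq0.
set y := x ^+ (2 * j).
have Ey : (x ^+ 2) ^+ j = y by rewrite -exprM.
have Ey1 : x ^+ (2 * j.+1) = x ^+ 2 * y by rewrite mulnS exprD.
have Ev : x ^+ N = v by [].
have Ev1 : x ^+ N.+1 = v * x by rewrite exprSr.
have Ev2 : x ^+ (2 * N) = v ^+ 2 by rewrite mulnC exprM.
have Ev4 : x ^+ (4 * N) = v ^+ 4 by rewrite mulnC exprM.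
have Ev21 : x ^+ (2 * N.+1) = v ^+ 2 * x ^+ 2 by rewrite mulnS exprD Ev2 mulrC.
have Ev41 : x ^+ (4 * N.+1) = v ^+ 4 * x ^+ 4 by rewrite mulnS exprD Ev4 mulrC.
have Ea : x ^+ (2 * N + 1) = v ^+ 2 * x by rewrite exprD Ev2 expr1.
have Eb : x ^+ (2 * N.+1 + 1) = v ^+ 2 * x ^+ 3.
  by rewrite exprD Ev21 -mulrA -exprSr.
have Ec : x ^+ (2 * N + 3) = v ^+ 2 * x ^+ 3 by rewrite exprD Ev2.
rewrite /wsummand /summand /cert_base Ey1 Ev Ev1 Ea Eb Ec Ev21 Ev41 Ev2 Ev4.
have d1 : 1 - x ^+ 2 * y != 0 by rewrite -Ey1 x_subr1_neq0; lia.
have d2 : 1 - v ^+ 4 * x != 0.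
  by rewrite -Ev4 -exprSr x_subr1_neq0; lia.
have d3 : 1 - v ^+ 4 * x ^+ 3 != 0.
  by rewrite -Ev4 -exprD x_subr1_neq0; lia.
have d4 : v ^+ 4 - x * y != 0.
  rewrite -Ev4 -exprS; case: (posnP N) => [N0|N_gt0]; last first.
    by rewrite -opprB oppr_eq0 x_exp_sub_neq0; lia.
  by rewrite N0 x_exp_sub_neq0; lia.
have d5 : v ^+ 4 * x - y != 0.
  by rewrite -Ev4 -exprSr -opprB oppr_eq0 x_exp_sub_neq0; lia.
rewrite !qpochSr Ey.
(* Each factorial belonging to N + 1, or having j + 1 factors, is expressed
   through the corresponding one in [cert_base x N j]. *)
have -> : qpoch (v ^+ 2 * x ^+ 2)^-1 (x ^+ 2) j * (1 - (v ^+ 2 * x ^+ 2)^-1 * y)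
   = (1 - 1 / (v * x) ^+ 2) * qpoch (v ^- 2) (x ^+ 2) j.
  by rewrite -Ey -qpochSr qpochSl; congr (_ * qpoch _ _ _);
    field; rewrite v0 x_neq0.
have -> : qpoch (v ^+ 2 * x) (x ^+ 2) j * (1 - v ^+ 2 * x * y)
   = (1 - v ^+ 2 * x) * qpoch (v ^+ 2 * x ^+ 3) (x ^+ 2) j.
  by rewrite -Ey -qpochSr qpochSl; congr (_ * qpoch _ _ _); ring.
have -> : qpoch (x / (v ^+ 4 * x ^+ 4)) (x ^+ 2) j
          * (1 - x / (v ^+ 4 * x ^+ 4) * y)
   = (1 - x / (v * x) ^+ 4) * (1 - 1 / (x * v ^+ 4)) / (1 - y / (x * v ^+ 4))
     * qpoch (x / v ^+ 4) (x ^+ 2) j.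
  rewrite -{1}Ey -qpochSr qpochSl.
  have -> : x / (v ^+ 4 * x ^+ 4) * x ^+ 2 = 1 / (x * v ^+ 4).
    by field; rewrite v0 x_neq0.
  have -> : x / v ^+ 4 = 1 / (x * v ^+ 4) * x ^+ 2.
    by field; rewrite v0 x_neq0.
  have e : 1 - y / (x * v ^+ 4) != 0.
    rewrite (_ : _ - _ = (v ^+ 4 * x - y) / (v ^+ 4 * x)); last first.
      by field; rewrite v0 x_neq0.
    by rewrite mulf_neq0 // invr_neq0 // mulf_neq0 // expf_neq0.
  have -> : qpoch (1 / (x * v ^+ 4)) (x ^+ 2) j =
     (1 - 1 / (x * v ^+ 4)) * qpoch (1 / (x * v ^+ 4) * x ^+ 2) (x ^+ 2) j
     / (1 - y / (x * v ^+ 4)).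
    apply: (mulIf e); rewrite divfK // -qpochSl qpochSr Ey.
    by congr (_ * (1 - _)); rewrite div1r mulrC.
  have -> : v ^+ 4 * x ^+ 4 = (v * x) ^+ 4 by rewrite exprMn.
  ring.
set a := qpoch _ _ _; set b := qpoch _ _ _; set p := qpoch _ _ _.
set c := qpoch _ _ _.
have E1 P Q R S : (a * P) ^+ 3 * (b * Q) / ((p * R) ^+ 3 * (c * S))
   = a ^+ 3 * b / (p ^+ 3 * c) * (P ^+ 3 * Q / (R ^+ 3 * S)).
  by rewrite !exprMn !invfM; ring.
have E2 P Q R S : (P * a) ^+ 3 * (b * Q) / ((p * R) ^+ 3 * (S * c))
   = a ^+ 3 * b / (p ^+ 3 * c) * (P ^+ 3 * Q / (R ^+ 3 * S)).
  by rewrite !exprMn !invfM; ring.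
have E3 P Q R S : (a * P) ^+ 3 * (Q * b) / ((p * R) ^+ 3 * (c * S))
   = a ^+ 3 * b / (p ^+ 3 * c) * (P ^+ 3 * Q / (R ^+ 3 * S)).
  by rewrite !exprMn !invfM; ring.
rewrite E2 E3 E1; move: (a ^+ 3 * b / _) => E.
rewrite /certificate /rec_new /rec_old; field.
rewrite v0 d4 d1 x_neq0 -[_ * _ - 1]opprB -[v ^+ 4 * _ - 1]opprB !oppr_eq0.
by rewrite [x * _]mulrC d2 d5 d3.
Qed.


(** The certificate at k = 0 also accounts for the initial terms, so the
    telescoped sum has no constant left over. *)
Lemma certificate_partial_sum j : (j <= N.+1)%N ->
  rec_new x v * (\sum_(k < j.+1) wsummand x N.+1 k)
  - rec_old x v * (\sum_(k < j.+1) wsummand x N k)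
  = certificate x v (x ^+ (2 * j)) * cert_base x N j.
Proof.
elim: j => [_|j IHj le_jN].
  rewrite !big_ord1 /wsummand /summand /cert_base !qpoch0 !muln0 !expr0 /=.
  rewrite /certificate /rec_new /rec_old (_ : x ^+ N.+1 = v * x) ?exprSr // -/v.
  by field; rewrite oner_neq0 x_neq0 v_neq0.
rewrite -certificate_step // -IHj ?(ltnW le_jN) // !(big_ord_recr j.+1) /=.
ring.
Qed.

(** Summed up to N + 1 the telescoping relation has right-hand side 0, because
    (x^(-2N); x^2)_(N+1) contains the factor 1 - x^(-2N) x^(2N). *)
Lemma wsummand_sum_rec :
  rec_new x v * (\sum_(k < N.+2) wsummand x N.+1 k)
  = rec_old x v * (\sum_(k < N.+1) wsummand x N k).
Proof.
have vanish : qpoch (x ^- (2 * N)) (x ^+ 2) N.+1 = 0.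
  by apply: (@qpoch_eq0 _ _ _ N) => //; rewrite -exprM mulVf ?expf_neq0.
have := certificate_partial_sum (leqnn N.+1).
rewrite [X in _ - _ * X](big_ord_recr N.+1) /=.
have -> : wsummand x N N.+1 = 0.
  by rewrite /wsummand /summand vanish expr0n /= !mul0r.
have -> : cert_base x N N.+1 = 0 by rewrite /cert_base vanish expr0n /= !mul0r.
by rewrite mulr0 addr0 => /subr0_eq.
Qed.

Lemma closed_form_rec :
  rec_new x v * closed_form x N.+1 = rec_old x v * closed_form x N.
Proof.
have v0 := v_neq0.
rewrite /closed_form (mulnS 3) (mulnS 2) binS bin1 !addSn !add0n !qpochSr.
rewrite exprD.
have q1 : qpoch x x N != 0.
  apply: qpoch_neq0 => i lt_iN; rewrite -exprS x_neq1 //; lia.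
have q2 : qpoch x (x ^+ 2) (2 * N) != 0.
  apply: qpoch_neq0 => i lt_iN; rewrite -exprM -exprS x_neq1 //; lia.
have Ev : x ^+ N = v by [].
have Ev1 : x ^+ N.+1 = v * x by rewrite exprSr.
have Ev2 : (x ^+ 2) ^+ N = v ^+ 2 by rewrite exprAC.
have Ev3 : x ^+ (3 * N) = v ^+ 3 by rewrite mulnC exprM.
have Ev31 : x ^+ (3 * N).+1 = v ^+ 3 * x by rewrite exprSr Ev3.
have Ev32 : x ^+ (3 * N).+2 = v ^+ 3 * x ^+ 2.
  by rewrite -addn2 exprD Ev3.
have Ev4 : (x ^+ 2) ^+ (2 * N) = v ^+ 4.
  by rewrite -exprM mulnA mulnC exprM.
have Ev41 : (x ^+ 2) ^+ (2 * N).+1 = v ^+ 4 * x ^+ 2 by rewrite exprSr Ev4.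
rewrite Ev Ev1 Ev2 Ev3 Ev31 Ev32 Ev4 Ev41.
have d1 : 1 - x * v != 0 by rewrite -exprS x_subr1_neq0; lia.
have d2 : 1 - x * v ^+ 4 != 0.
  by rewrite -Ev4 -exprM -exprS x_subr1_neq0; lia.
have d3 : 1 - x * (v ^+ 4 * x ^+ 2) != 0.
  by rewrite -Ev41 -exprM -exprS x_subr1_neq0; lia.
have c0 : x ^+ 'C(N.+1, 2) != 0 by rewrite expf_neq0.
rewrite /rec_new /rec_old; move: (x ^+ 'C(N.+1, 2)) c0 => c c0.
by field; rewrite c0 q2 q1 v0 x_neq0 d3 d2 d1.
Qed.

End Telescoping.

(** This special case of Jackson's 8phi7 summation only requires that x is not a
    root of unity of positive order below 4N, which leaves room for the order
    4N + 1 needed below. *)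
Theorem wsummand_sum (K : fieldType) (x : K) N :
    x != 0 -> (forall i, (0 < i < 4 * N)%N -> x ^+ i != 1) ->
  \sum_(k < N.+1) wsummand x N k = 2 * closed_form x N.
Proof.
move=> x0; elim: N => [_|N IHN x_neq1].
  rewrite big_ord1 /wsummand /summand /closed_form !muln0 !qpoch0 !expr0.
  by field; rewrite oner_neq0.
have x_neq1' i : (0 < i < 4 * N + 4)%N -> x ^+ i != 1.
  by move=> h; apply: x_neq1; lia.
have d0 : rec_new x (x ^+ N) != 0.
  rewrite /rec_new -exprSr -!exprM -exprSr -exprD.
  by rewrite !mulf_neq0 ?expf_neq0 // subr_eq0 eq_sym x_neq1; lia.
apply: (mulfI d0); rewrite wsummand_sum_rec // IHN => [|i hi]; last first.
  by apply: x_neq1; lia.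
by rewrite mulrCA -closed_form_rec // mulrCA.
Qed.
(** * Specialisation to a root of unity of order 4m + 1 *)

Section RootOfUnity.
Variables (K : fieldType) (m : nat) (z : K).
Hypothesis z_prim : (4 * m + 1).-primitive_root z.

Lemma z_neq0 : z != 0.
Proof.
apply/eqP => z0; have := prim_expr_order z_prim.
by rewrite z0 addn1 expr0n => /esym/eqP; rewrite oner_eq0.
Qed.

Lemma z_exp_period i j : i = j %[mod 4 * m + 1] -> z ^+ i = z ^+ j.
Proof. by move=> h; apply/eqP; rewrite (eq_prim_root_expr z_prim) h. Qed.

Lemma z_exp_eq i j c : (i = j + c * (4 * m + 1))%N -> z ^+ i = z ^+ j.
Proof. by move=> ->; apply: z_exp_period; rewrite addnC modnMDl. Qed.

(** The order 4m + 1 is odd, so z^2 and z^4 are primitive as well. *)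
Lemma z_exp2_neq1 e i : (0 < i < 4 * m + 1)%N -> (z ^+ (2 ^ e)) ^+ i != 1.
Proof.
move=> /andP[i_gt0 lt_in]; rewrite -exprM -(prim_order_dvd z_prim).
rewrite Gauss_dvdr; last by rewrite coprimeXr // coprimen2; lia.
by apply/negP => /(dvdn_leq i_gt0); lia.
Qed.

(** The factor 1 - z z^(4m) is 0: this is where the sum stops. *)
Lemma qpoch_z_tail k : (m < k)%N -> qpoch z (z ^+ 4) k = 0.
Proof.
move=> h; apply: (@qpoch_eq0 _ _ _ m) => //.
by rewrite -exprM -exprS -(expr0 z); apply: (@z_exp_eq _ _ 1); lia.
Qed.

Let term k :=
  qpoch z (z ^+ 4) k ^+ 4 / qpoch (z ^+ 4) (z ^+ 4) k ^+ 4 * z ^+ (4 * k).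

Lemma summand_z k : summand (z ^+ 2) m k = term k.
Proof.
rewrite /summand /term -!exprM.
have -> : z ^- (2 * (2 * m)) = z.
  apply: (mulfI (expf_neq0 (2 * (2 * m)) z_neq0)).
  rewrite mulfV ?expf_neq0 ?z_neq0 // -exprSr -(expr0 z).
  by apply: esym; apply: (@z_exp_eq _ _ 1); lia.
have -> : z ^+ (2 * (2 * m + 1)) = z.
  by rewrite -[RHS]expr1; apply: (@z_exp_eq _ _ 1); lia.
have -> : z ^+ 2 / z ^+ (2 * (4 * m)) = z ^+ 4.
  apply: (mulIf (expf_neq0 (2 * (4 * m)) z_neq0)).
  rewrite divfK ?expf_neq0 ?z_neq0 // -exprD.
  by apply: esym; apply: (@z_exp_eq _ _ 2); lia.
by rewrite -!exprSr mulnA.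
Qed.

Lemma qpoch_z4_neq0 k : (k <= 4 * m)%N -> qpoch (z ^+ 4) (z ^+ 4) k != 0.
Proof.
move=> le_k; apply: qpoch_neq0 => i lt_ik.
by rewrite -exprS (z_exp2_neq1 2) //; lia.
Qed.

(** With p = z^4 and z p^m = 1, reflection exchanges the arguments z and p in a
    factorial with m factors, and z p^(m-k) with p (or p^(m-k+1) with z) in one
    with k factors.  Splitting (z; p)_m and (p; p)_m after m - k factors and
    reflecting everything gives the ratio. *)
Lemma qpoch_z_ratio_rev k : (k <= m)%N ->
  qpoch z (z ^+ 4) (m - k) / qpoch (z ^+ 4) (z ^+ 4) (m - k)
  = (- z) ^+ m * (z ^+ 4) ^+ 'C(m, 2) * z ^+ (3 * k)
    * (qpoch z (z ^+ 4) k / qpoch (z ^+ 4) (z ^+ 4) k).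
Proof.
move=> le_km; set j := (m - k)%N; have Em : m = (j + k)%N by rewrite subnK.
have z0 := z_neq0; have p0 : z ^+ 4 != 0 by rewrite expf_neq0.
have Pj0 : qpoch (z ^+ 4) (z ^+ 4) j != 0 by rewrite qpoch_z4_neq0; lia.
have Pk0 : qpoch (z ^+ 4) (z ^+ 4) k != 0 by rewrite qpoch_z4_neq0; lia.
have zp_m i : i = m -> z * (z ^+ 4) * (z ^+ 4) ^+ i = z ^+ 4.
  by move=> ->; rewrite -exprM -exprS -exprD; apply: (@z_exp_eq _ _ 1); lia.
have Em_refl := qpoch_reflect p0 (zp_m m erefl).
have Ez : z * (z ^+ 4) ^+ j * z ^+ 4 * (z ^+ 4) ^+ k = z ^+ 4.
  by rewrite -[RHS](zp_m (j + k)%N) // (exprD (z ^+ 4)); ring.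
have Ep : z ^+ 4 * (z ^+ 4) ^+ j * z * (z ^+ 4) ^+ k = z ^+ 4.
  by rewrite -[RHS](zp_m (j + k)%N) // (exprD (z ^+ 4)); ring.
move: Em_refl.
(* Only the two factorials are split; the power of - z keeps its exponent m. *)
rewrite {1 4}Em !qpochD (qpoch_reflect p0 Ez) (qpoch_reflect p0 Ep).
set c := (- z) ^+ m * _.
have -> : (- (z ^+ 4 * (z ^+ 4) ^+ j)) ^+ k
   = (- (z * (z ^+ 4) ^+ j)) ^+ k * z ^+ (3 * k).
  by rewrite exprM -exprMn; congr (_ ^+ k); ring.
set d := (- (z * _)) ^+ k.
have d0 : d != 0 by rewrite expf_neq0 // oppr_eq0 mulf_neq0 // expf_neq0.
have e0 : (z ^+ 4) ^+ 'C(k, 2) != 0 by rewrite expf_neq0.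
move=> E; apply: (mulIf d0); apply: (mulIf e0); apply: (mulIf Pk0).
apply: (mulIf Pj0).
transitivity (qpoch z (z ^+ 4) j
              * (d * (z ^+ 4) ^+ 'C(k, 2) * qpoch (z ^+ 4) (z ^+ 4) k)).
  by field.
by rewrite E; field.
Qed.

(** The powers of z of [qpoch_z_ratio_rev], raised to the fourth power, combine
    with z^(4(m-k)) to z^(8k-2m) modulo the period, since
    4m + 16 C(m,2) + 4m + 2m = 2m (4m + 1). *)
Lemma term_rev k : (k <= m)%N ->
  term (m - k) = z ^+ (4 * k) / z ^+ (2 * m) * term k.
Proof.
move=> le_km; have z0 := z_neq0.
rewrite /term -!expr_div_n qpoch_z_ratio_rev // exprMn.
set w := (qpoch _ _ _ / qpoch _ _ _) ^+ 4.
have -> : ((- z) ^+ m * (z ^+ 4) ^+ 'C(m, 2) * z ^+ (3 * k)) ^+ 4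
   = z ^+ (4 * m + 16 * 'C(m, 2) + 12 * k).
  rewrite !exprMn -(exprAC _ 4) exprNn -signr_odd expr0 mul1r -!exprM -!exprD.
  by congr (_ ^+ _); lia.
apply: (mulIf (expf_neq0 (2 * m) z0)).
transitivity (w * z ^+ (4 * m + 16 * 'C(m, 2) + 12 * k + 4 * (m - k) + 2 * m)).
  by rewrite !exprD; ring.
transitivity (w * z ^+ (8 * k)).
  congr (_ * _); apply: (@z_exp_eq _ _ (2 * m)).
  have := bin2_double m; nia.
rewrite (_ : 8 * k = 4 * k + 4 * k)%N ?exprD; last by lia.
by field; rewrite expf_neq0.
Qed.

(** The average of the sum and of its reversal is half of the very-well-poised
    sum. *)
Lemma term_sum : (2 : K) != 0 ->
  \sum_(k < m.+1) term k = closed_form (z ^+ 2) m.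
Proof.
move=> two_neq0; apply: (mulfI two_neq0).
rewrite -wsummand_sum ?expf_neq0 ?z_neq0 //; last first.
  by move=> i hi; rewrite (z_exp2_neq1 1) //; lia.
have -> : \sum_(k < m.+1) wsummand (z ^+ 2) m k
  = \sum_(k < m.+1) term k + \sum_(k < m.+1) term (m - k).
  rewrite -big_split; apply: eq_bigr => k _ /=.
  rewrite /wsummand summand_z mulrDr mulr1 term_rev; last by rewrite -ltnS.
  rewrite -!exprM !mulnA.
  by rewrite [_ * term k]mulrC.
rewrite [X in _ = _ + X](reindex_inj rev_ord_inj) /=.
rewrite [X in _ = _ + X](eq_bigr (fun k : 'I_m.+1 => term k)) => [|k _].
  by rewrite mulr2n mulrDl !mul1r.
by rewrite subSS subKn; last by rewrite -ltnS.
Qed.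

(** Modulo n = 4m + 1 the exponents m+1, ..., 2m are the negatives of
    2m+1, ..., 3m, so each of the upper two thirds of (x; x)_(3m) is (z; x)_m
    up to sign and a power of x; likewise for the upper half of
    (x; x^2)_(2m) and (x^2; x^2)_m. *)
Lemma closed_form_z :
  closed_form (z ^+ 2) m =
  z ^+ m * (qpoch z (z ^+ 2) m ^+ 2 * qpoch (z ^+ 2) (z ^+ 4) m
    / (qpoch (z ^+ 2) (z ^+ 2) m ^+ 2 * qpoch (z ^+ 4) (z ^+ 4) m)).
Proof.
have z0 := z_neq0; set x := z ^+ 2; have x0 : x != 0 by rewrite expf_neq0.
have Ez : z = x ^+ (2 * m + 1).
  by rewrite -exprM -[LHS]expr1; apply/esym/(@z_exp_eq _ _ 1); lia.
have Ep : x ^+ 2 = z ^+ 4 by rewrite -exprM.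
have p0 : z ^+ 4 != 0 by rewrite expf_neq0.
have x_neq1 i : (0 < i < 4 * m + 1)%N -> x ^+ i != 1 := @z_exp2_neq1 1 i.
have A0 : qpoch x (z ^+ 4) m != 0.
  by apply: qpoch_neq0 => i hi; rewrite -Ep -exprM -exprS x_neq1 //; lia.
have B0 : qpoch x x m != 0.
  by apply: qpoch_neq0 => i hi; rewrite -exprS x_neq1 //; lia.
have P0 : qpoch (z ^+ 4) (z ^+ 4) m != 0 by rewrite qpoch_z4_neq0; lia.
rewrite /closed_form Ep (_ : 3 * m = m + (m + m))%N; last by lia.
rewrite (_ : 2 * m = m + m)%N; last by lia.
rewrite !qpochD.
have -> : x * x ^+ m * x ^+ m = z.
  by rewrite -!exprS -exprD Ez; congr (_ ^+ _); lia.
have -> : x * (z ^+ 4) ^+ m = z.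
  by rewrite -Ep -exprM -exprS [RHS]Ez addn1.
rewrite (@qpoch_reflect _ (x * x ^+ m) z x m) //; last first.
  rewrite {1}Ez -exprS -!exprD -[RHS]expr1 -!exprM.
  by apply: (@z_exp_eq _ _ 2); lia.
rewrite (@qpoch_reflect _ z (z ^+ 4) (z ^+ 4) m) //; last first.
  rewrite -exprS -exprM -exprD.
  by apply: (@z_exp_eq _ _ 1); lia.
rewrite (exprNn (x * x ^+ m)) (exprNn z).
set s := (-1) ^+ m; have s0 : s != 0 by rewrite signr_eq0.
have -> : (x * x ^+ m) ^+ m
  = z ^+ m * z ^+ m * (z ^+ 4) ^+ 'C(m, 2) * x ^+ 'C(m.+1, 2)
    / x ^+ 'C(m, 2).
  apply: (mulIf (expf_neq0 'C(m, 2) x0)); rewrite divfK ?expf_neq0 //.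
  rewrite -exprS -!exprM -!exprD binS bin1; congr (_ ^+ _).
  by have := bin2_double m; nia.
by field; rewrite P0 B0 s0 A0 !expf_neq0.
Qed.

End RootOfUnity.

(** * From values at a root of unity to congruences *)

(** 'Phi_n is the minimal polynomial of z over the rationals. *)
Lemma size_Cyclotomic_le (n : nat) (z : algC) (P : {poly int}) :
  n.-primitive_root z -> P != 0 -> root (map_poly intr P) z ->
  (size 'Phi_n <= size P)%N.
Proof.
move=> z_prim P0 Pz; have [r [Dr _] dv_r] := minCpolyP z.
have size_r : size r = size 'Phi_n.
  rewrite -(size_map_poly (ratr : {rmorphism rat -> algC})) -Dr.
  rewrite (minCpoly_cyclotomic z_prim) -(Cintr_Cyclotomic z_prim).
  by rewrite size_map_inj_poly //; exact: intr_inj.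
have sizeQ : size (map_poly (intr : int -> rat) P) = size P.
  by rewrite size_map_inj_poly //; exact: intr_inj.
have : root (map_poly ratr (map_poly (intr : int -> rat) P)) z.
  rewrite -map_poly_comp (eq_map_poly (g := intr)) // => i /=.
  by rewrite ratr_int.
rewrite dv_r -size_r -sizeQ; apply: dvdp_leq.
by rewrite -size_poly_eq0 sizeQ size_poly_eq0.
Qed.

(** As 'Phi_n is monic, Euclidean division by it stays within integer
    polynomials. *)
Lemma zdvdp_Cyclotomic (n : nat) (z : algC) (P : {poly int}) :
  n.-primitive_root z -> root (map_poly intr P) z -> zdvdp 'Phi_n P.
Proof.
move=> z_prim Pz; have Phi_mon := Cyclotomic_monic n.
have Phi_z : root (map_poly intr 'Phi_n) z.
  by rewrite (Cintr_Cyclotomic z_prim) root_cyclotomic.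
exists (Pdiv.Ring.rdivp P 'Phi_n).
have := Pdiv.RingMonic.rdivp_eq Phi_mon P.
set Q := Pdiv.Ring.rdivp _ _; set r := Pdiv.Ring.rmodp _ _ => DP.
suff r0 : r = 0 by rewrite {1}DP r0 addr0 mulrC.
apply/eqP/negPn/negP => r_neq0.
have : (size r < size 'Phi_n)%N by rewrite Pdiv.Ring.ltn_rmodpN0 // monic_neq0.
rewrite ltnNge (size_Cyclotomic_le z_prim) //.
move: Pz; rewrite DP rmorphD rmorphM /= !rootE hornerD hornerM.
by rewrite (rootP Phi_z) mulr0 add0r.
Qed.

(** In a factorisation 'Phi_n = D W one factor vanishes at z.  If D divides V, it
    is W, so W has full degree and D is constant; being monic, 'Phi_n then
    forces this constant to be invertible in the integers. *)
Lemma zcoprimep_Cyclotomic (n : nat) (z : algC) (V : {poly int}) :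
  n.-primitive_root z -> ~~ root (map_poly intr V) z -> zcoprimep V 'Phi_n.
Proof.
move=> z_prim Vz D [V' DV] [W DPhi].
have Phi_mon := Cyclotomic_monic n.
have Phi_neq0 := monic_neq0 Phi_mon.
have [D0 W0] : D != 0 /\ W != 0.
  by apply/andP; rewrite -negb_or -mulf_eq0 -DPhi.
have : root (map_poly intr 'Phi_n) z.
  by rewrite (Cintr_Cyclotomic z_prim) root_cyclotomic.
rewrite DPhi rmorphM /= rootM => /orP[Dz | Wz].
  by case/negP: Vz; rewrite DV rmorphM /= rootM Dz.
have := size_Cyclotomic_le z_prim W0 Wz; rewrite DPhi size_mul //.
have := size_poly_gt0 D; have := size_poly_gt0 W.
rewrite D0 W0 => W_gt0 D_gt0 le_size.
have size_D : (size D <= 1)%N.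
  rewrite -(prednK D_gt0) addSn /= -{2}[size W]add0n leq_add2r leqn0 in le_size.
  by rewrite -(prednK D_gt0) (eqP le_size).
have /size_poly1P[c c0 Dc] : size D == 1%N by rewrite eqn_leq D_gt0 size_D.
have := monicP Phi_mon; rewrite DPhi lead_coefM Dc lead_coefC => c_unit.
rewrite poly_unitE size_polyC c0 coefC /=.
by apply/unitrPr; exists (lead_coef W).
Qed.

(** F is regular at z with value c.  A relation is used because elements of the
    fraction field carry no canonical numerator and denominator. *)
Definition value_at (z : algC) (F : ratfun) (c : algC) : Prop :=
  exists U V : {poly int},
    [/\ ~~ root (map_poly intr V) z, F = tofrac U / tofrac V
      & c = (map_poly intr U).[z] / (map_poly intr V).[z]].

Section ValueAt.
Variable z : algC.
Implicit Types (F G : ratfun) (c d : algC).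

Lemma poly_neq0_at (V : {poly int}) : ~~ root (map_poly intr V) z -> V != 0.
Proof. by apply: contra => /eqP->; rewrite rmorph0 root0. Qed.

Lemma value_at_poly (P : {poly int}) :
  value_at z (tofrac P) (map_poly intr P).[z].
Proof.
exists P, 1; rewrite rmorph1 !hornerE rmorph1 !divr1; split=> //.
by rewrite rootE hornerE oner_eq0.
Qed.

Lemma value_atM F G c d :
  value_at z F c -> value_at z G d -> value_at z (F * G) (c * d).
Proof.
move=> [U [V [Vz -> ->]]] [U' [V' [Vz' -> ->]]]; exists (U * U'), (V * V').
rewrite !rmorphM /= rootM negb_or Vz Vz' !hornerM !invfM; split=> //.
  by rewrite mulrACA.
by rewrite mulrACA.
Qed.

Lemma value_atB F G c d :
  value_at z F c -> value_at z G d -> value_at z (F - G) (c - d).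
Proof.
move=> [U [V [Vz -> ->]]] [U' [V' [Vz' -> ->]]].
exists (U * V' - U' * V), (V * V').
rewrite !(rmorphM, rmorphB) /= rootM negb_or Vz Vz' !(hornerM, hornerD, hornerN).
split=> //.
  by rewrite -mulNr -addf_div ?mulNr ?tofrac_eq0 ?(poly_neq0_at Vz) ?(poly_neq0_at Vz').
by rewrite -mulNr addf_div -?rootE // mulNr.
Qed.

Lemma value_atV F c : c != 0 -> value_at z F c -> value_at z F^-1 c^-1.
Proof.
move=> c0 [U [V [Vz -> Dc]]]; exists V, U; rewrite !invf_div Dc invf_div.
split=> //; apply: contra c0 => /rootP Uz; by rewrite Dc Uz mul0r.
Qed.

Lemma value_atX F c k : value_at z F c -> value_at z (F ^+ k) (c ^+ k).
Proof.
move=> h; elim: k => [|k IHk]; last by rewrite !exprS; exact: value_atM.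
by have := value_at_poly 1; rewrite !rmorph1 hornerE.
Qed.

Lemma value_at_prod k (f : nat -> ratfun) (g : nat -> algC) :
  (forall i, (i < k)%N -> value_at z (f i) (g i)) ->
  value_at z (\prod_(i < k) f i) (\prod_(i < k) g i).
Proof.
elim: k => [_|k IHk h].
  by rewrite !big_ord0; have := value_at_poly 1; rewrite !rmorph1 hornerE.
rewrite !big_ord_recr; apply: value_atM; last exact: h.
by apply: IHk => i hi; apply: h; lia.
Qed.

Lemma value_at_sum k (f : nat -> ratfun) (g : nat -> algC) :
  (forall i, (i < k)%N -> value_at z (f i) (g i)) ->
  value_at z (\sum_(i < k) f i) (\sum_(i < k) g i).
Proof.
have v0 : value_at z 0 0.
  by have := value_at_poly 0; rewrite !rmorph0 hornerE.
elim: k => [_|k IHk h]; first by rewrite !big_ord0.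
rewrite !big_ord_recr /= -[X in X + f k]opprK -[X in X + g k]opprK.
rewrite ![- - _ + _]addrC -[- \sum_(i < k) f i]sub0r -[- \sum_(i < k) g i]sub0r.
apply: value_atB; first exact: h.
by apply: value_atB => //; apply: IHk => i hi; apply: h; lia.
Qed.

Lemma value_at_q : value_at z q z.
Proof. by have := value_at_poly 'X; rewrite map_polyX hornerX. Qed.

Lemma value_at_qpoch F G c d k :
  value_at z F c -> value_at z G d -> value_at z (qpoch F G k) (qpoch c d k).
Proof.
move=> hF hG.
apply: (@value_at_prod k (fun i => 1 - F * G ^+ i) (fun i => 1 - c * d ^+ i)).
move=> i _; apply: value_atB; last exact/value_atM/value_atX.
by have := value_at_poly 1; rewrite !rmorph1 hornerE.
Qed.

End ValueAt.

Lemma qcongr_of_values (n : nat) (z : algC) (F G : ratfun) (c : algC) :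
  n.-primitive_root z -> value_at z F c -> value_at z G c -> qcongr 'Phi_n F G.
Proof.
move=> z_prim hF hG; have [U [V [Vz DFG]]] := value_atB hF hG.
rewrite subrr => /esym/eqP.
rewrite mulf_eq0 invr_eq0 -!rootE (negPf Vz) orbF => Uz.
exists U, V; split=> //.
- exact: poly_neq0_at Vz.
- exact: zcoprimep_Cyclotomic Vz.
- exact: zdvdp_Cyclotomic Uz.
Qed.

Theorem theorem2 (n : nat) (n_gt1 : (1 < n)%N) (n_mod4 : n = 1 %[mod 4]) :
  qcongr 'Phi_n
    (\sum_(0 <= k < n)
       qpoch q (q ^+ 4) k ^+ 4 / qpoch (q ^+ 4) (q ^+ 4) k ^+ 4 * q ^+ (4 * k))
    (q ^+ ((n - 1) %/ 4)
     * (qpoch q (q ^+ 2) ((n - 1) %/ 4) ^+ 2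
        * qpoch (q ^+ 2) (q ^+ 4) ((n - 1) %/ 4)
        / (qpoch (q ^+ 2) (q ^+ 2) ((n - 1) %/ 4) ^+ 2
           * qpoch (q ^+ 4) (q ^+ 4) ((n - 1) %/ 4)))).
Proof.
set m := ((n - 1) %/ 4)%N.
have Dn : n = (4 * m + 1)%N by rewrite /m; lia.
have [z] := C_prim_root_exists (ltnW n_gt1); rewrite Dn => z_prim.
have Vq := value_at_q z.
have Vqe e : value_at z (q ^+ e) (z ^+ e) by exact: value_atX.
apply: (qcongr_of_values (c := closed_form (z ^+ 2) m) z_prim); last first.
  rewrite (closed_form_z z_prim).
  apply: value_atM => //; apply: value_atM; last apply: value_atV.
  - by apply: value_atM; [apply: value_atX|]; apply: value_at_qpoch.
  - rewrite mulf_neq0 ?expf_neq0 ?(qpoch_z4_neq0 z_prim) //; last by lia.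
    apply: qpoch_neq0 => i hi; rewrite -exprS (z_exp2_neq1 z_prim 1) //; lia.
  - by apply: value_atM; [apply: value_atX|]; apply: value_at_qpoch.
have two_neq0 : (2 : algC) != 0 by rewrite Num.Theory.pnatr_eq0.
rewrite -(term_sum z_prim two_neq0) big_mkord.
pose f k : algC :=
  qpoch z (z ^+ 4) k ^+ 4 / qpoch (z ^+ 4) (z ^+ 4) k ^+ 4 * z ^+ (4 * k).
rewrite -[X in value_at z _ X]/(\sum_(k < m.+1) f k).
have -> : \sum_(k < m.+1) f k = \sum_(k < 4 * m + 1) f k.
  rewrite (_ : 4 * m + 1 = m.+1 + 3 * m)%N; last by lia.
  rewrite big_split_ord /= [X in _ + X]big1 ?addr0 // => i _.
  by rewrite /f (qpoch_z_tail z_prim) ?expr0n ?mul0r //= ltnS leq_addr.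
apply: (@value_at_sum z _
  (fun k => qpoch q (q ^+ 4) k ^+ 4 / qpoch (q ^+ 4) (q ^+ 4) k ^+ 4
            * q ^+ (4 * k))).
move=> k lt_k; apply: value_atM => //; apply: value_atM; last apply: value_atV.
- by apply: value_atX; apply: value_at_qpoch.
- by rewrite expf_neq0 // (qpoch_z4_neq0 z_prim) //; lia.
- by apply: value_atX; apply: value_at_qpoch.
Qed.
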